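(* Let $\mathcal T_3$ denote the set of all directed trees with three arcs. For any two non-isomorphic $T,T'\in\mathcal T_3$ there exist host digraphs $H_>$ and $H_<$ such that $$\hom(T,H_>)>\hom(T',H_>)\qquad\text{and}\qquad \hom(T,H_<)<\hom(T',H_<).$$ In particular, the homomorphism order $\preceq$ restricted to $\mathcal T_3$ is discrete, i.e. for $T,T'\in\mathcal T_3$, $T\preceq T'$ holds only if $T$ and $T'$ are isomorphic.
   Context: A digraph is a finite directed simple loopless graph: at most one arc for each ordered pair of distinct vertices (opposite arcs are allowed). A directed tree is an orientation of a finite undirected tree. $\hom(D,H)$ is the number of digraph homomorphisms $D\to H$ (maps $V(D)\to V(H)$ sending arcs to arcs, preserving direction). One writes $T\preceq T'$ if $\hom(T,H)\le\hom(T',H)$ for all finite digraphs $H$. *)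

(* Defs.v *)
From mathcomp Require Import all_boot.

Set Implicit Arguments.
Unset Strict Implicit.
Unset Printing Implicit Defensive.

(* Having arcs given by a boolean relation means at most one arc per ordered
   pair; irreflexivity excludes loops.  Opposite arcs are allowed. *)
Record digraph := Digraph {
  vertex :> finType;
  arc : rel vertex;
  arc_irr : irreflexive arc
}.
Arguments arc {d} x y.

Definition is_hom (D H : digraph) (f : {ffun D -> H}) : bool :=
  [forall x, forall y, arc x y ==> arc (f x) (f y)].

Definition hom (D H : digraph) : nat := #|[set f : {ffun D -> H} | is_hom f]|.

Definition iso (D D' : digraph) : Prop :=
  exists f : D -> D', bijective f /\ forall x y, arc (f x) (f y) = arc x y.

Definition hom_le (D D' : digraph) : Prop :=
  forall H : digraph, hom D H <= hom D' H.

(* [e] is the adjacency relation of an undirected graph on [V]; since [e] is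
   symmetric, [:: x; y] is a [ucycle] whenever [e x y], so genuine cycles are
   those with at least three vertices. *)
Definition is_tree (V : finType) (e : rel V) : Prop :=
  [/\ symmetric e, irreflexive e, 0 < #|V|,
      forall x y, connect e x y
    & forall p : seq V, 2 < size p -> ~ ucycle e p].

Definition is_orientation (V : finType) (e a : rel V) : Prop :=
  (forall x y, e x y = a x y || a y x) /\
  (forall x y, ~~ (a x y && a y x)).

Definition directed_tree (D : digraph) : Prop :=
  exists2 e : rel D, is_tree e & is_orientation e arc.

Definition num_arcs (D : digraph) : nat := #|[set u : D * D | arc u.1 u.2]|.

Definition tree3 (T : digraph) : Prop := directed_tree T /\ num_arcs T = 3.

(* Main.v *)
From mathcomp Require Import all_boot.
Require Import Defs.

(** A tree with three arcs has four vertices, so its underlying tree is the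
    star or the path, and up to isomorphism there are eight of them: four
    stars, one for each number of arcs leaving the centre, and four paths, as
    reading the path from its other end identifies the 2^3 orientations in
    pairs ([models], [tree3_model]).

    It remains to find hosts that order these eight trees in enough ways. With
    o and i for out-degree and in-degree in the host, a star with a arcs
    leaving and b arcs entering its centre has sum_v o(v)^a i(v)^b
    homomorphisms, and a path is counted by summing over the image u -> v of
    its middle arc:
<<
      0 -> 1 -> 2 -> 3   sum i(u) o(v)       0 -> 1 -> 2 <- 3   sum i(u) i(v)
      0 <- 1 -> 2 -> 3   sum o(u) o(v)       0 -> 1 <- 2 -> 3   sum o(u) i(v)
>>
    These statistics can be played against each other. The delicate comparison
    is between the directed and the alternating path: the former wins only if
    arcs tend to lead from large in-degree to large out-degree, as the arc
    0 -> 1 does in the last of the four [hosts]. Those hosts, each on five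
    vertices, have the property that for every ordered pair of distinct trees
    among the eight some host admits strictly more homomorphisms from the first
    ([hom_tableE], [models_separated]); taking the pair in both orders gives
    both inequalities.

    For the classification, a connected digraph is exhausted by adding one arc
    at a time, each to a new vertex ([growth]). If it has one vertex more than
    arcs, these arcs are all its arcs ([iso_growth]), which leaves 48 labelled
    trees to compare with the models. The same process bounds the number of
    vertices by four; conversely, at most three vertices can carry three edges
    only as a triangle ([tree3_order]). *)

Set Implicit Arguments.
Unset Strict Implicit.
Unset Printing Implicit Defensive.

(** * Isomorphism and homomorphism counts *)

Lemma iso_trans (D1 D2 D3 : digraph) : iso D1 D2 -> iso D2 D3 -> iso D1 D3.
Proof.
move=> [f [bij_f fE]] [g [bij_g gE]]; exists (g \o f).
by split=> [|x y]; [apply: bij_comp | rewrite gE fE].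
Qed.

Lemma iso_sym (D D' : digraph) : iso D D' -> iso D' D.
Proof.
move=> [f [[g fK gK] fE]]; exists g; split; first by exists f.
by move=> x y; rewrite -fE !gK.
Qed.

Lemma is_homP (D H : digraph) (f : {ffun D -> H}) :
  reflect (forall x y, arc x y -> arc (f x) (f y)) (is_hom f).
Proof.
apply: (iffP forallP) => [h x y | h x].
  by move: (h x) => /forallP /(_ y) /implyP.
by apply/forallP=> y; apply/implyP; apply: h.
Qed.

(** Composition with the isomorphism D -> D' is injective on homomorphisms. *)
Lemma leq_hom_iso (D D' H : digraph) : iso D D' -> hom D' H <= hom D H.
Proof.
move=> [f [[g fK gK] fE]].
pose pull (h : {ffun D' -> H}) := [ffun x => h (f x)].
have pull_inj : injective pull.
  move=> h1 h2 /ffunP eq12; apply/ffunP=> y.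
  by have := eq12 (g y); rewrite !ffunE gK.
rewrite /hom -(card_imset _ pull_inj); apply/subset_leq_card/subsetP=> h' /imsetP[h].
rewrite !inE => /is_homP hom_h ->{h'}; apply/is_homP=> x y xy.
by rewrite !ffunE hom_h ?fE.
Qed.

Lemma hom_iso (D D' H : digraph) : iso D D' -> hom D H = hom D' H.
Proof.
by move=> isoD; apply/eqP; rewrite eqn_leq !leq_hom_iso //; apply: iso_sym.
Qed.

(** * Digraphs given by arc lists *)

(** Discarding loops from the list makes this irreflexive for every [L]. *)
Definition list_arc n (L : seq (nat * nat)) (i j : 'I_n) : bool :=
  (i != j) && ((i : nat, j : nat) \in L).
Arguments list_arc n L i j /.

Lemma list_arc_irr n L : irreflexive (@list_arc n L).
Proof. by move=> i; rewrite /= eqxx. Qed.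

Definition list_digraph n L : digraph := Digraph (@list_arc_irr n L).

Fixpoint words n m : seq (seq nat) :=
  if m is m'.+1 then [seq x :: w | x <- iota 0 n, w <- words n m'] else [:: [::]].

Lemma mem_words n m w : (w \in words n m) = (size w == m) && all (ltn^~ n) w.
Proof.
elim: m w => [|m IHm] [|x w] //=; first by apply/allpairsP=> -[[? ?] []].
apply/allpairsP/idP => [[[y v] /= []] | /andP[szw /andP[ltx allw]]].
  by rewrite mem_iota IHm add0n => /= lty /andP[/eqP<- allv] [-> ->]; rewrite eqxx lty.
by exists (x, w); rewrite /= mem_iota ltx IHm -eqSS szw.
Qed.

Lemma words_uniq n m : uniq (words n m).
Proof.
elim: m => [|m IHm] //=; rewrite allpairs_uniq ?iota_uniq //.
by move=> [x v] [y w] _ _ /= [-> ->].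
Qed.

Definition simple_list (L : seq (nat * nat)) := all (fun u => u.1 != u.2) L.

Definition word_hom (M L : seq (nat * nat)) (w : seq nat) :=
  all (fun u => (nth 0 w u.1, nth 0 w u.2) \in L) M.

(** Encoding a map by the word of its values turns the count over the finite
    function type, which does not reduce, into one that can be evaluated. *)
Lemma hom_list_digraph m n M L :
    simple_list M -> simple_list L -> all (fun u => (u.1 < m) && (u.2 < m)) M ->
  hom (list_digraph m M) (list_digraph n L) = count (word_hom M L) (words n m).
Proof.
move=> /allP irrM /allP irrL /allP ltM.
pose word (f : {ffun 'I_m -> 'I_n}) : seq nat := [seq val (f i) | i <- enum 'I_m].
have nth_word f (i : 'I_m) : nth 0 (word f) i = f i.
  by rewrite (nth_map i) ?size_enum_ord // nth_ord_enum.
have size_word f : size (word f) = m by rewrite size_map size_enum_ord.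
have word_inj : injective word.
  move=> f g eq_fg; apply/ffunP=> i; apply: val_inj.
  by rewrite /= -!nth_word eq_fg.
have homE f : is_hom (D := list_digraph m M) (H := list_digraph n L) f
              = word_hom M L (word f).
  apply/is_homP/allP => /= [hom_f [i j] ijM | hom_w i j /andP[_ ijM]].
    have /andP[/= lti ltj] := ltM _ ijM.
    have := hom_f (Ordinal lti) (Ordinal ltj); rewrite ijM andbT -val_eqE.
    move=> /(_ (irrM _ ijM)) /andP[_].
    by rewrite -!nth_word.
  have := hom_w _ ijM; rewrite /= !nth_word => fijL.
  by rewrite fijL andbT -val_eqE (irrL _ fijL).
rewrite /hom cardE -(size_map word) -size_filter; apply/perm_size/uniq_perm.
- by rewrite map_inj_uniq // enum_uniq.
- by rewrite filter_uniq // words_uniq.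
move=> w; rewrite mem_filter mem_words; apply/mapP/and3P.
  move=> [f]; rewrite mem_enum inE homE => homf ->.
  split=> //; first by rewrite size_word.
  by apply/allP=> _ /mapP[i _ ->]; apply: ltn_ord.
move=> [homw /eqP szw /allP ltw].
have ltwi (i : 'I_m) : nth 0 w i < n by apply/ltw/mem_nth; rewrite szw.
pose f := [ffun i => Ordinal (ltwi i)].
have wordf : word f = w.
  apply: (@eq_from_nth _ 0) => [|i]; rewrite size_word ?szw // => lti.
  by rewrite (nth_word _ (Ordinal lti)) ffunE.
by exists f; rewrite // mem_enum inE homE wordf.
Qed.

(** * Growing a connected digraph one arc at a time *)

Definition attachments k : seq (nat * nat) :=
  [seq (p, k) | p <- iota 0 k] ++ [seq (k, p) | p <- iota 0 k].

(** Each growth records a way to build a connected digraph on 0, ..., k: the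
    latest arc comes first, and it joins the largest vertex k to an earlier
    one. *)
Fixpoint growths k : seq (seq (nat * nat)) :=
  if k is k'.+1 then [seq u :: L | u <- attachments k, L <- growths k'] else [:: [::]].

Lemma mem_attachments k p :
  p < k -> ((p, k) \in attachments k) && ((k, p) \in attachments k).
Proof.
move=> ltp; rewrite !mem_cat.
by rewrite (map_f (pair^~ k)) ?(map_f (pair k)) ?orbT // mem_iota.
Qed.

Lemma attachments_max k u : u \in attachments k -> maxn u.1 u.2 = k.
Proof.
by rewrite mem_cat => /orP[] /mapP[p + ->] /=; rewrite mem_iota => /ltnW;
  [move/maxn_idPr | move/maxn_idPl].
Qed.

(** The arcs of a growth are distinct because their larger endpoints are. *)
Lemma growths_wf k L : L \in growths k ->
  [/\ size L = k, uniq L & {in L, forall u, maxn u.1 u.2 <= k}].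
Proof.
elim: k L => [|k IHk] L; first by rewrite inE => /eqP->.
move=> /allpairsP[[u L'] /= [/attachments_max maxu /IHk[szL' uniqL' leL'] ->]].
split=> /=; first by rewrite szL'.
  by rewrite uniqL' andbT; apply/negP=> /leL'; rewrite maxu ltnn.
by move=> v; rewrite inE => /predU1P[->|/leL'/leqW //]; rewrite maxu.
Qed.

Definition adjacent (D : digraph) (x y : D) : bool := arc x y || arc y x.

Section Growth.

Variables (D : digraph) (x0 : D).

Hypothesis conn : forall x y : D, connect (@adjacent D) x y.

Let at_ (s : seq D) (u : nat * nat) : D * D := (nth x0 s u.1, nth x0 s u.2).

(** The entries of [s] are the vertices in order of discovery. *)
Definition realizes (s : seq D) (L : seq (nat * nat)) : Prop :=
  uniq s /\ {in L, forall u, arc (at_ s u).1 (at_ s u).2}.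

(** As long as some vertex is missing from [s], connectedness provides an arc
    with exactly one endpoint in [s]; that arc and its other endpoint extend
    the growth. *)
Lemma growth k : k < #|D| ->
  exists2 s : seq D, size s = k.+1 & exists2 L, L \in growths k & realizes s L.
Proof.
elim: k => [|k IHk] ltk; first by exists [:: x0] => //; exists [::].
have [s szs [L growL [uniqs arcL]]] := IHk (ltnW ltk).
have [z zs] : exists z, z \notin s.
  apply/existsP; rewrite -negb_forall; apply: contraTN ltk => /forallP all_s.
  rewrite -leqNgt -szs; apply: leq_trans (card_size s).
  by apply/subset_leq_card/subsetP.
(* If no arc crossed the boundary of s, then s would be closed under adjacency. *)
have [[x y] /= /andP[axy cross]|noX] :=
    pickP [pred u : D * D | arc u.1 u.2 & (u.1 \in s) != (u.2 \in s)]; last first.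
  have cls : closed (@adjacent D) (mem s).
    move=> u v /= /orP[auv|avu].
      by have := noX (u, v); rewrite /= auv => /negbFE/eqP.
    by have := noX (v, u); rewrite /= avu => /negbFE/eqP.
  have := closed_connect cls (conn (nth x0 s 0) z).
  by rewrite /= mem_nth ?szs // (negbTE zs).
have extend v u : v \notin s -> u \in attachments k.+1 ->
    arc (at_ (rcons s v) u).1 (at_ (rcons s v) u).2 ->
  exists2 s' : seq D, size s' = k.+2 & exists2 L', L' \in growths k.+1 & realizes s' L'.
  move=> vs uk arcu; exists (rcons s v); first by rewrite size_rcons szs.
  exists (u :: L); first exact: allpairs_f.
  split=> [|t]; first by rewrite rcons_uniq vs.
  rewrite inE => /predU1P[-> //|tL].
  have [_ _ /(_ _ tL)] := growths_wf growL; rewrite geq_max => /andP[le1 le2].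
  by have := arcL _ tL; rewrite /= !nth_rcons szs !ltnS le1 le2.
have [xs|xs] := boolP (x \in s).
  have ys : y \notin s by move: cross; rewrite xs; case: (y \in s).
  have lti : index x s < k.+1 by rewrite -szs index_mem.
  have /andP[at1 at2] := mem_attachments lti.
  apply: (extend y _ ys at1).
  by rewrite /= !nth_rcons szs lti ltnn eqxx nth_index.
have ys : y \in s by move: cross; rewrite (negbTE xs); case: (y \in s).
have lti : index y s < k.+1 by rewrite -szs index_mem.
have /andP[at1 at2] := mem_attachments lti.
apply: (extend x _ xs at2).
by rewrite /= !nth_rcons szs lti ltnn eqxx nth_index.
Qed.

Lemma realizes_arcs k s L :
    size s = k.+1 -> L \in growths k -> realizes s L ->
  let A := [seq at_ s u | u <- L] in
  [/\ uniq A, size A = k & {subset A <= enum [set u : D * D | arc u.1 u.2]}].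
Proof.
move=> szs growL [uniqs arcL] A; have [szL uniqL leL] := growths_wf growL.
have ltL u : u \in L -> (u.1 < size s) && (u.2 < size s).
  by move/leL; rewrite geq_max szs.
split; rewrite ?size_map //; last first.
  by move=> _ /mapP[u uL ->]; rewrite mem_enum inE; apply: arcL.
rewrite map_inj_in_uniq // => -[i j] [i' j'] /ltL/andP[/= lti ltj] /ltL/andP[/= lti' ltj'].
by move=> [/eqP + /eqP]; rewrite !nth_uniq // => /eqP-> /eqP->.
Qed.

Lemma leq_order_num_arcs : #|D| <= (num_arcs D).+1.
Proof.
case D0: #|D| => [//|n]; have [|s szs [L growL pl]] := @growth n; first by rewrite D0.
have [uniqA szA subA] := realizes_arcs szs growL pl.
by have := uniq_leq_size uniqA subA; rewrite szA -cardE.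
Qed.

(** The n arcs of a growth on all n + 1 vertices are distinct, so there is no
    room for a further arc of [D]. *)
Lemma iso_growth n :
  num_arcs D = n -> #|D| = n.+1 -> exists2 L, L \in growths n & iso (list_digraph n.+1 L) D.
Proof.
move=> arcsn ordn; have [|s szs [L growL pl]] := @growth n; first by rewrite ordn.
have [uniqA szA subA] := realizes_arcs szs growL pl.
have [|_ memA] := uniq_min_size uniqA subA; first by rewrite szA -cardE -arcsn.
have [[uniqs _] [_ _ leL]] := (pl, growths_wf growL).
exists L => //; exists (fun i : 'I_n.+1 => nth x0 s i).
have nth_inj : injective (fun i : 'I_n.+1 => nth x0 s i).
  by move=> i j /eqP; rewrite nth_uniq ?szs // => /eqP/val_inj.
split=> [|i j]; first by apply: inj_card_bij; rewrite ?card_ord ?ordn.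
have -> : arc (nth x0 s i) (nth x0 s j) = ((i : nat, j : nat) \in L).
  transitivity (at_ s (i : nat, j : nat) \in [seq at_ s u | u <- L]).
    by rewrite memA mem_enum inE.
  apply/mapP/idP => [[[i' j'] uL] | ijL]; last by exists (i : nat, j : nat).
  have := leL _ uL; rewrite geq_max /= => /andP[lei lej].
  by move=> [/eqP + /eqP]; rewrite !nth_uniq ?szs // => /eqP-> /eqP->.
rewrite /= andb_idl // => ijL; apply: contraTneq (pl.2 _ ijL) => -> /=.
by rewrite arc_irr.
Qed.

End Growth.

(** * Three arcs make a tree have four vertices *)

(** The set of ordered adjacent pairs is the disjoint union of the arcs and the
    reversed arcs. *)
Lemma num_arcs_orientation (D : digraph) (e : rel D) :
    is_orientation e arc -> #|[set u : D * D | e u.1 u.2]| = (num_arcs D).*2.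
Proof.
move=> [eE anti]; pose A := [set u : D * D | arc u.1 u.2].
pose swap (u : D * D) := (u.2, u.1).
have swapK : involutive swap by case.
have -> : [set u : D * D | e u.1 u.2] = A :|: swap @^-1: A.
  by apply/setP=> u; rewrite !inE eE.
rewrite cardsU (card_preimset _ (inv_inj swapK)) -addnn.
suff -> : A :&: swap @^-1: A = set0 by rewrite cards0 subn0.
by apply/setP=> u; rewrite !inE; apply/negbTE/anti.
Qed.

Lemma card_offdiag (V : finType) :
  #|[set u : V * V | u.1 != u.2]| = #|V| * #|V|.-1.
Proof.
have -> : [set u : V * V | u.1 != u.2] = ~: [set (x, x) | x : V].
  apply/setP=> -[x y]; rewrite !inE /=; congr (~~ _).
  apply/eqP/imsetP => [<-|[z _ [-> ->]]] //; by exists x.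
have := cardsC [set (x, x) | x : V].
rewrite card_prod card_imset; last by move=> x y [].
by move=> cV; apply: (@addnI #|V|); rewrite cV; case: #|V| => // n; rewrite -mulnS.
Qed.

Lemma connect_adjacent (T : digraph) (x y : T) :
  directed_tree T -> connect (@adjacent T) x y.
Proof.
by move=> [e [_ _ _ conn _] [eE _]]; rewrite -(eq_connect (e := e)).
Qed.

(** Connectedness gives at most four vertices. Three edges are six ordered pairs
    of distinct vertices; two vertices have only two such pairs, and three
    vertices have exactly six, so that they would form a triangle. *)
Lemma tree3_order (T : digraph) : tree3 T -> #|T| = 4.
Proof.
move=> [treeT arcs3].
have conn (x y : T) : connect (@adjacent T) x y by apply: connect_adjacent.
have [e [sym irr V0 _ acyc] ori] := treeT.
apply/eqP; rewrite eqn_leq; apply/andP; split.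
  by have /card_gt0P[x0 _] := V0; rewrite -arcs3 (leq_order_num_arcs x0).
rewrite ltnNge; apply/negP=> le3.
pose E := [set u : T * T | e u.1 u.2].
have cE : #|E| = 6 by rewrite num_arcs_orientation // arcs3.
have subE : E \subset [set u : T * T | u.1 != u.2].
  apply/subsetP=> -[x y]; rewrite !inE /=; apply: contraTneq => ->.
  by rewrite irr.
have := subset_leqif_card subE; rewrite cE card_offdiag.
have : size (enum T) = #|T| by rewrite -cardE.
case V3: #|T| V0 le3 => [|[|[|[|]]]] // _ _ sz3 [] //= _ /esym full.
have eE x y : x != y -> e x y.
  by move=> xy; have := subsetP full (x, y); rewrite !inE /=; apply.
case: (enum T) (enum_uniq T) sz3 => [|x [|y [|z [|]]]] //= uniqT _.
apply: (acyc [:: x; y; z]) => //; apply/andP; split=> //=.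
move: uniqT; rewrite !inE negb_or => /and3P[/andP[xy xz] yz _].
by rewrite !eE // eq_sym.
Qed.

(** * The eight trees with three arcs *)

(** First the stars centred at 0, by decreasing out-degree of the centre, then
    the paths 0, 1, 2, 3, up to reversal. *)
Definition models : seq (seq (nat * nat)) :=
  [:: [:: (0, 1); (0, 2); (0, 3)];
      [:: (0, 1); (0, 2); (3, 0)];
      [:: (0, 1); (2, 0); (3, 0)];
      [:: (1, 0); (2, 0); (3, 0)];
      [:: (0, 1); (1, 2); (2, 3)];
      [:: (0, 1); (1, 2); (3, 2)];
      [:: (1, 0); (1, 2); (2, 3)];
      [:: (0, 1); (2, 1); (2, 3)]].

Definition model k : digraph := list_digraph 4 (nth [::] models k).

Definition relabels (p : seq nat) (L M : seq (nat * nat)) :=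
  all (fun i => all (fun j => ((nth 0 p i, nth 0 p j) \in M) == ((i, j) \in L))
                    (iota 0 4)) (iota 0 4).

(** There are 2 * 4 * 6 = 48 growths with three arcs: the k-th arc has k possible
    earlier endpoints and two directions. *)
Lemma relabel_model :
  all (fun L => has (fun M => has (fun p => relabels p L M) (permutations (iota 0 4))) models)
      (growths 3).
Proof. by vm_compute. Qed.

Lemma iso_relabels p L M :
  perm_eq p (iota 0 4) -> relabels p L M -> iso (list_digraph 4 L) (list_digraph 4 M).
Proof.
move=> perm_p relp.
have szp : size p = 4 by rewrite (perm_size perm_p).
have ltp (i : 'I_4) : nth 0 p i < 4.
  by have := mem_nth 0 (_ : i < size p); rewrite szp (perm_mem perm_p) mem_iota; apply.
pose f (i : 'I_4) := Ordinal (ltp i).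
have f_inj : injective f.
  move=> i j [] /eqP; rewrite nth_uniq ?szp // => [/eqP/val_inj //|].
  by rewrite (perm_uniq perm_p).
exists f; split=> [|i j]; first exact: injF_bij.
rewrite /= (inj_eq f_inj); congr (_ && _).
move/allP/(_ (i : nat)): relp; rewrite mem_iota => /(_ (ltn_ord i))/allP/(_ (j : nat)).
by rewrite mem_iota => /(_ (ltn_ord j))/eqP.
Qed.

Lemma tree3_model (T : digraph) :
  tree3 T -> exists2 k, k < size models & iso T (model k).
Proof.
move=> tree_T; have ord4 := tree3_order tree_T.
have [treeT arcs3] := tree_T; have [x0 _] : exists x0 : T, x0 \in T.
  by apply/card_gt0P; rewrite ord4.
have [L growL isoL] : exists2 L, L \in growths 3 & iso (list_digraph 4 L) T.
  by apply: (iso_growth x0) => // x y; apply: connect_adjacent.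
have /hasP[M M_model /hasP[p]] := allP relabel_model L growL.
rewrite mem_permutations => perm_p /(iso_relabels perm_p) isoM.
exists (index M models); first by rewrite index_mem.
by rewrite /model nth_index //; apply: iso_trans (iso_sym isoL) isoM.
Qed.

(** * Hosts separating the eight trees *)

(** The first host is acyclic, without a directed path of length three, and it
    favours trees whose vertices are mostly sources and sinks: it orders the
    eight trees strictly. The second and third hosts are reversals of each
    other: a complete symmetric triangle, into which each tree has 24
    homomorphisms, perturbed by a pendant directed path leaving, respectively
    entering, it. The last is the directed triangle 0 -> 1 -> 2 -> 0 with 2
    replaced by the three vertices 2, 3, 4, together with the two arcs opposite
    to 2 -> 0 and 1 -> 2. *)
Definition hosts : seq (seq (nat * nat)) :=
  [:: [:: (0, 1); (0, 2); (0, 4); (1, 2); (1, 3)];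
      [:: (0, 1); (1, 0); (0, 2); (2, 0); (1, 2); (2, 1); (0, 3); (3, 4)];
      [:: (0, 1); (1, 0); (0, 2); (2, 0); (1, 2); (2, 1); (3, 0); (4, 3)];
      [:: (0, 1); (1, 2); (1, 3); (1, 4); (2, 0); (3, 0); (4, 0); (0, 2); (2, 1)]].

Definition host h : digraph := list_digraph 5 (nth [::] hosts h).

(** Rows are indexed by hosts and columns by models. Reversing all arcs exchanges
    the columns 0 and 3, 1 and 2, 5 and 6; this maps the second row to the third
    and fixes the last. *)
Definition hom_table : seq (seq nat) :=
  (*   k =  0   1   2   3   4   5   6   7 *)
  [:: [::  35;  4;  2; 11;  0;  3;  6; 18];
      [::  44; 35; 29; 26; 30; 27; 35; 32];
      [::  26; 29; 35; 44; 30; 35; 27; 32];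
      [::  45; 40; 40; 45; 37; 36; 36; 36]].

Lemma hom_tableE h k :
    h < size hosts -> k < size models ->
  hom (model k) (host h) = nth 0 (nth [::] hom_table h) k.
Proof.
have tableP : all (fun h => all (fun k =>
      count (word_hom (nth [::] models k) (nth [::] hosts h)) (words 5 4)
        == nth 0 (nth [::] hom_table h) k)
    (iota 0 (size models))) (iota 0 (size hosts)) by vm_compute.
move=> lth ltk; rewrite hom_list_digraph.
- move/allP/(_ h): tableP; rewrite mem_iota => /(_ lth)/allP/(_ k).
  by rewrite mem_iota => /(_ ltk)/eqP.
- have /allP := isT : all simple_list models; apply; exact: mem_nth.
- have /allP := isT : all simple_list hosts; apply; exact: mem_nth.
have /allP := isT : all (all (fun u => (u.1 < 4) && (u.2 < 4))) models.
by apply; apply: mem_nth.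
Qed.

(** Any ordered pair of distinct columns of the table has a row in which the
    first column exceeds the second. The first row alone decides one of each
    two opposite pairs. Column 4, the directed path, exceeds column 7, the
    alternating path, in the last row only. *)
Lemma models_separated i j :
    i < size models -> j < size models -> i != j ->
  exists H : digraph, hom (model j) H < hom (model i) H.
Proof.
have sepP : all (fun i => all (fun j => (i != j) ==>
      has (fun row => nth 0 row j < nth 0 row i) hom_table)
    (iota 0 (size models))) (iota 0 (size models)) by vm_compute.
move=> lti ltj ij.
move/allP/(_ i): sepP; rewrite mem_iota => /(_ lti)/allP/(_ j).
rewrite mem_iota ij => /(_ ltj)/hasP[row] /(nthP [::])[h lth <-] lt_row.
by exists (host h); rewrite !hom_tableE.
Qed.

Lemma tree3_iso_or_separated (T T' : digraph) :
    tree3 T -> tree3 T' ->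
  iso T T' \/ exists H : digraph, hom T' H < hom T H.
Proof.
move=> /tree3_model[i lti isoT] /tree3_model[j ltj isoT'].
have [eq_ij | neq_ij] := eqVneq i j; [left | right].
  by apply: iso_trans isoT _; rewrite eq_ij; apply: iso_sym.
have [H ltH] := models_separated lti ltj neq_ij.
by exists H; rewrite (hom_iso H isoT) (hom_iso H isoT').
Qed.

Theorem proposition3p1 :
  (forall T T' : digraph, tree3 T -> tree3 T' -> ~ iso T T' ->
     (exists Hgt : digraph, hom T Hgt > hom T' Hgt) /\
     (exists Hlt : digraph, hom T Hlt < hom T' Hlt)) /\
  (forall T T' : digraph, tree3 T -> tree3 T' -> hom_le T T' -> iso T T').
Proof.
split=> [T T' treeT treeT' noniso | T T' treeT treeT' le_hom].
  split; first by case: (tree3_iso_or_separated treeT treeT').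
  by case: (tree3_iso_or_separated treeT' treeT) => // /iso_sym.
by case: (tree3_iso_or_separated treeT treeT') => // -[H]; rewrite ltnNge le_hom.
Qed.
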